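(* Let $\mathcal{A}$ be an additive $k$-category, $m$ a positive integer, and $f:X\to Y$ a morphism in $\mathbf{C}^b(\mathcal{A})$. If $\mathcal{F}_m(f):\mathcal{F}_m(X)\to\mathcal{F}_m(Y)$ is irreducible in $\mathbf{C}_{\equiv m}(\mathcal{A})$, then $f$ is irreducible in $\mathbf{C}^b(\mathcal{A})$.
   Context: $k$ is a commutative ring. $\mathbf{C}^b(\mathcal{A})$ is the category of bounded cochain complexes over $\mathcal{A}$. $\mathbf{C}_{\equiv m}(\mathcal{A})$ is the category of $m$-periodic complexes: complexes $X=(X^i,d_X^i)_{i\in\mathbb{Z}}$ with $X^i=X^j$ and $d_X^i=d_X^j$ whenever $i\equiv j\pmod m$; morphisms are chain maps $(f^i)$ with $f^i=f^j$ whenever $i\equiv j\pmod m$. The compression functor $\mathcal{F}_m:\mathbf{C}^b(\mathcal{A})\to\mathbf{C}_{\equiv m}(\mathcal{A})$ is given by $\mathcal{F}_m(X)^i=\bigoplus_{t\in\mathbb{Z}}X^{i+tm}$ with diagonal differential with components $d_X^{i+tm}$, and $\mathcal{F}_m(f)^i$ is diagonal with components $f^{i+tm}$. A morphism $f:X\to Y$ in an additive category is a section (resp. retraction) if there is $h:Y\to X$ with $hf=1_X$ (resp. $fh=1_Y$). It is irreducible if it is neither a section nor a retraction and, whenever $f=hg$, either $g$ is a section or $h$ is a retraction. *)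

(* Defs.v *)
From HB Require Import structures.
From mathcomp Require Import all_boot all_order all_algebra.
From mathcomp Require Import zify boolp.

Set Implicit Arguments.
Unset Strict Implicit.
Unset Printing Implicit Defensive.

Import GRing.Theory.
Local Open Scope ring_scope.

Record category := Category {
  obj :> Type;
  mor : obj -> obj -> Type;
  idc : forall X, mor X X;
  compc : forall X Y Z, mor Y Z -> mor X Y -> mor X Z;
  compc1m : forall X Y (f : mor X Y), compc (idc Y) f = f;
  compcm1 : forall X Y (f : mor X Y), compc f (idc X) = f;
  compcA : forall X Y Z W (h : mor Z W) (g : mor Y Z) (f : mor X Y),
    compc h (compc g f) = compc (compc h g) f }.
Arguments idc {_} X.
Arguments compc {_ X Y Z} g f.

Definition section (C : category) (X Y : C) (f : mor X Y) : Prop :=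
  exists h : mor Y X, compc h f = idc X.

Definition retraction (C : category) (X Y : C) (f : mor X Y) : Prop :=
  exists h : mor Y X, compc f h = idc Y.

Definition irreducible (C : category) (X Y : C) (f : mor X Y) : Prop :=
  [/\ ~ section f, ~ retraction f &
      forall (Z : C) (g : mor X Z) (h : mor Z Y),
        f = compc h g -> section g \/ retraction h].

Record functor (C D : category) := Functor {
  fob :> C -> D;
  fmap : forall X Y : C, mor X Y -> mor (fob X) (fob Y);
  fmap1 : forall X : C, fmap (idc X) = idc (fob X);
  fmapM : forall (X Y Z : C) (g : mor Y Z) (f : mor X Y),
    fmap (compc g f) = compc (fmap g) (fmap f) }.
Arguments fmap {C D} F {X Y} f : rename.

(* The ground ring may be trivial. Binary biproducts are a choice of data,   *)
(* so everything below holds for whichever direct sums are chosen.           *)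
Record additive (k : comPzRingType) := Additive {
  aobj :> Type;
  hom : aobj -> aobj -> lmodType k;
  idm : forall X, hom X X;
  comp : forall X Y Z, hom Y Z -> hom X Y -> hom X Z;
  comp1m : forall X Y (f : hom X Y), comp (idm Y) f = f;
  compm1 : forall X Y (f : hom X Y), comp f (idm X) = f;
  compA : forall X Y Z W (h : hom Z W) (g : hom Y Z) (f : hom X Y),
    comp h (comp g f) = comp (comp h g) f;
  compDl : forall X Y Z (g g' : hom Y Z) (f : hom X Y),
    comp (g + g') f = comp g f + comp g' f;
  compDr : forall X Y Z (g : hom Y Z) (f f' : hom X Y),
    comp g (f + f') = comp g f + comp g f';
  compZl : forall X Y Z (a : k) (g : hom Y Z) (f : hom X Y),
    comp (a *: g) f = a *: comp g f;
  compZr : forall X Y Z (a : k) (g : hom Y Z) (f : hom X Y),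
    comp g (a *: f) = a *: comp g f;
  zero_obj : aobj;
  from_zero : forall X (f : hom zero_obj X), f = 0;
  to_zero : forall X (f : hom X zero_obj), f = 0;
  bip : aobj -> aobj -> aobj;
  in1 : forall X Y, hom X (bip X Y);
  in2 : forall X Y, hom Y (bip X Y);
  pr1 : forall X Y, hom (bip X Y) X;
  pr2 : forall X Y, hom (bip X Y) Y;
  pr1_in1 : forall X Y, comp (pr1 X Y) (in1 X Y) = idm X;
  pr2_in2 : forall X Y, comp (pr2 X Y) (in2 X Y) = idm Y;
  pr1_in2 : forall X Y, comp (pr1 X Y) (in2 X Y) = 0;
  pr2_in1 : forall X Y, comp (pr2 X Y) (in1 X Y) = 0;
  bip_id : forall X Y,
    comp (in1 X Y) (pr1 X Y) + comp (in2 X Y) (pr2 X Y) = idm (bip X Y) }.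
Arguments hom {k A} X Y : rename.
Arguments idm {k A} X : rename.
Arguments comp {k A X Y Z} g f : rename.
Arguments zero_obj {k A} : rename.
Arguments bip {k A} X Y : rename.
Arguments in1 {k A X Y} : rename.
Arguments in2 {k A X Y} : rename.
Arguments pr1 {k A X Y} : rename.
Arguments pr2 {k A X Y} : rename.

Notation "g \c f" := (comp g f) (at level 40, left associativity).

Definition is_zero k (A : additive k) (Z : A) : Prop :=
  (forall Y (f : hom Z Y), f = 0) /\ (forall Y (f : hom Y Z), f = 0).

Section Complexes.
Variables (k : comPzRingType) (A : additive k).

Lemma comp0m (X Y Z : A) (f : hom X Y) : (0 : hom Y Z) \c f = 0.
Proof. by have := compZl 0 (0 : hom Y Z) f; rewrite !scale0r. Qed.

Lemma compm0 (X Y Z : A) (g : hom Y Z) : g \c (0 : hom X Y) = 0.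
Proof. by have := compZr 0 g (0 : hom X Y); rewrite !scale0r. Qed.

Record complex := Complex {
  cob :> int -> A;
  d : forall i, hom (cob i) (cob (i + 1));
  dd : forall i, d (i + 1) \c d i = 0 }.
Arguments d X i : rename.

Record chain_map (X Y : complex) := ChainMap {
  cmap :> forall i, hom (X i) (Y i);
  cmapP : forall i, d Y i \c cmap i = cmap (i + 1) \c d X i }.

Lemma chain_map_eq (X Y : complex) (f g : chain_map X Y) :
  (forall i, f i = g i) -> f = g.
Proof.
case: f g => f fP [g gP] /= E.
have {}E : f = g by apply: functional_extensionality_dep.
by case: _ / E gP => gP; congr ChainMap; apply: Prop_irrelevance.
Qed.

Lemma chain_idP (X : complex) i : d X i \c idm (X i) = idm (X (i + 1)) \c d X i.
Proof. by rewrite compm1 comp1m. Qed.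

Definition chain_id (X : complex) : chain_map X X := ChainMap (@chain_idP X).

Lemma chain_compP (X Y Z : complex) (g : chain_map Y Z) (f : chain_map X Y) i :
  d Z i \c (g i \c f i) = (g (i + 1) \c f (i + 1)) \c d X i.
Proof. by rewrite compA cmapP -compA cmapP compA. Qed.

Definition chain_comp (X Y Z : complex) (g : chain_map Y Z)
  (f : chain_map X Y) : chain_map X Z := ChainMap (@chain_compP X Y Z g f).

Lemma chain_comp1m (X Y : complex) (f : chain_map X Y) :
  chain_comp (chain_id Y) f = f.
Proof. by apply: chain_map_eq => i; apply: comp1m. Qed.

Lemma chain_compm1 (X Y : complex) (f : chain_map X Y) :
  chain_comp f (chain_id X) = f.
Proof. by apply: chain_map_eq => i; apply: compm1. Qed.

Lemma chain_compA (X Y Z W : complex) (h : chain_map Z W) (g : chain_map Y Z)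
  (f : chain_map X Y) :
  chain_comp h (chain_comp g f) = chain_comp (chain_comp h g) f.
Proof. by apply: chain_map_eq => i; apply: compA. Qed.

Record bcomplex := BComplex {
  bcx :> complex;
  bounded : exists N : nat, forall i : int, (N < `|i|)%N -> is_zero (bcx i) }.

Definition Cb : category := {|
  obj := bcomplex;
  mor := fun X Y => chain_map X Y;
  idc := fun X => chain_id X;
  compc := fun X Y Z g f => chain_comp g f;
  compc1m := fun X Y => @chain_comp1m X Y;
  compcm1 := fun X Y => @chain_compm1 X Y;
  compcA := fun X Y Z W => @chain_compA X Y Z W |}.

(* A morphism bundled with its domain and codomain: [Arrow f = Arrow g] is   *)
(* equality of morphisms of A whose endpoints are equal but not convertible. *)
Record arrow := Arrow { adom : A; acod : A; amor : hom adom acod }.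

Lemma Arrow_inj (X Y : A) (f g : hom X Y) : Arrow f = Arrow g -> f = g.
Proof.
have K (a b : arrow) (e : a = b) (p : adom a = adom b) (q : acod a = acod b) :
    ecast Z (hom (adom b) Z) q (ecast Z (hom Z (acod a)) p (amor a)) = amor b.
  case: _ / e p q => p q.
  by rewrite (Prop_irrelevance p erefl) (Prop_irrelevance q erefl).
by move=> e; apply: (K _ _ e erefl erefl).
Qed.

Lemma Arrow_comp (X Y Z X' Y' Z' : A) (g : hom Y Z) (f : hom X Y)
    (g' : hom Y' Z') (f' : hom X' Y') :
  Arrow g = Arrow g' -> Arrow f = Arrow f' -> Arrow (g \c f) = Arrow (g' \c f').
Proof.
move=> eg ef.
have eX : X = X' := congr1 adom ef.
have eY : Y = Y' := congr1 acod ef.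
have eZ : Z = Z' := congr1 acod eg.
subst X' Y' Z'.
by rewrite (Arrow_inj eg) (Arrow_inj ef).
Qed.

Section Periodic.
Variable m : nat.

Record pcomplex := PComplex {
  pcx :> complex;
  per_ob : forall i j : int, (i = j %[mod m])%Z -> pcx i = pcx j;
  per_d : forall i j : int, (i = j %[mod m])%Z ->
    Arrow (d pcx i) = Arrow (d pcx j) }.

Record pmap (X Y : pcomplex) := PMap {
  pcmap :> chain_map X Y;
  per_map : forall i j : int, (i = j %[mod m])%Z ->
    Arrow (pcmap i) = Arrow (pcmap j) }.

Lemma pmap_eq (X Y : pcomplex) (f g : pmap X Y) :
  (forall i, f i = g i) -> f = g.
Proof.
case: f g => f fP [g gP] /= /chain_map_eq E.
by case: _ / E gP => gP; congr PMap; apply: Prop_irrelevance.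
Qed.

Lemma pmap_idP (X : pcomplex) (i j : int) : (i = j %[mod m])%Z ->
  Arrow (chain_id X i) = Arrow (chain_id X j).
Proof. by move=> /(per_ob X) /= ->. Qed.

Definition pmap_id (X : pcomplex) : pmap X X := PMap (@pmap_idP X).

Lemma pmap_compP (X Y Z : pcomplex) (g : pmap Y Z) (f : pmap X Y) (i j : int) :
  (i = j %[mod m])%Z ->
  Arrow (chain_comp g f i) = Arrow (chain_comp g f j).
Proof. by move=> e; apply: Arrow_comp; apply: per_map. Qed.

Definition pmap_comp (X Y Z : pcomplex) (g : pmap Y Z) (f : pmap X Y) :
  pmap X Z := PMap (@pmap_compP X Y Z g f).

Lemma pmap_comp1m (X Y : pcomplex) (f : pmap X Y) : pmap_comp (pmap_id Y) f = f.
Proof. by apply: pmap_eq => i; apply: comp1m. Qed.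

Lemma pmap_compm1 (X Y : pcomplex) (f : pmap X Y) : pmap_comp f (pmap_id X) = f.
Proof. by apply: pmap_eq => i; apply: compm1. Qed.

Lemma pmap_compA (X Y Z W : pcomplex) (h : pmap Z W) (g : pmap Y Z)
  (f : pmap X Y) : pmap_comp h (pmap_comp g f) = pmap_comp (pmap_comp h g) f.
Proof. by apply: pmap_eq => i; apply: compA. Qed.

Definition Cper : category := {|
  obj := pcomplex;
  mor := pmap;
  idc := pmap_id;
  compc := pmap_comp;
  compc1m := pmap_comp1m;
  compcm1 := pmap_compm1;
  compcA := pmap_compA |}.

End Periodic.

Fixpoint dsum (X : int -> A) (s : seq int) : A :=
  if s is j :: s' then bip (X j) (dsum X s') else zero_obj.

Fixpoint dcol (T : A) (Y : int -> A) (phi : forall j, hom T (Y j))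
    (s : seq int) : hom T (dsum Y s) :=
  if s is j :: s' then in1 \c phi j + in2 \c dcol phi s' else 0.

(* The morphism of direct sums with matrix phi: its component X j -> Y j' is *)
(* phi j j'.                                                                 *)
Fixpoint dmat (X Y : int -> A) (phi : forall j j', hom (X j) (Y j'))
    (s s' : seq int) : hom (dsum X s) (dsum Y s') :=
  if s is j :: s1 then dcol (phi j) s' \c pr1 + dmat phi s1 s' \c pr2 else 0.

(* The matrix whose only nonzero entries are phi j, from X j to Y (h j); for *)
(* h = id it is diagonal, for h = +1 it sends the summand j to j + 1.        *)
Definition spread (h : int -> int) (X Y : int -> A)
    (phi : forall j, hom (X j) (Y (h j))) (j j' : int) : hom (X j) (Y j') :=
  match h j =P j' with
  | ReflectT e => ecast z (hom (X j) (Y z)) e (phi j)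
  | ReflectF _ => 0
  end.

Lemma dcol_comp (T T' : A) (Y : int -> A) (phi : forall j, hom T (Y j))
    (u : hom T' T) s : dcol phi s \c u = dcol (fun j => phi j \c u) s.
Proof.
by elim: s => [|j s IH] /=; rewrite ?comp0m // compDl -!compA IH.
Qed.

Lemma dcolD (T : A) (Y : int -> A) (phi psi : forall j, hom T (Y j)) s :
  dcol (fun j => phi j + psi j) s = dcol phi s + dcol psi s.
Proof.
elim: s => [|j s IH] /=; first by rewrite addr0.
by rewrite IH !compDr addrACA.
Qed.

Lemma eq_dcol (T : A) (Y : int -> A) (phi psi : forall j, hom T (Y j)) s :
  {in s, forall j, phi j = psi j} -> dcol phi s = dcol psi s.
Proof.
elim: s => [//|j s IH] H /=; rewrite H ?mem_head // IH // => i si.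
by apply: H; rewrite inE si orbT.
Qed.

Lemma dcol0 (T : A) (Y : int -> A) (phi : forall j, hom T (Y j)) s :
  {in s, forall j, phi j = 0} -> dcol phi s = 0.
Proof.
elim: s => [//|j s IH] H /=; rewrite H ?mem_head // IH ?compm0 ?addr0 // => i si.
by apply: H; rewrite inE si orbT.
Qed.

Lemma eq_dmat (X Y : int -> A) (phi psi : forall j j', hom (X j) (Y j')) s s' :
  {in s & s', forall j j', phi j j' = psi j j'} ->
  dmat phi s s' = dmat psi s s'.
Proof.
elim: s => [//|j s IH] H /=; congr (_ + _); congr comp.
  by apply: eq_dcol => j' sj'; apply: H; rewrite ?mem_head.
by apply: IH => i j' si sj'; apply: H; rewrite // inE si orbT.
Qed.

Lemma dmat0 (X Y : int -> A) (phi : forall j j', hom (X j) (Y j')) s s' :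
  {in s & s', forall j j', phi j j' = 0} -> dmat phi s s' = 0.
Proof.
elim: s => [//|j s IH] H /=; rewrite dcol0; last first.
  by move=> j' sj'; apply: H; rewrite ?mem_head.
rewrite IH ?comp0m ?addr0 // => i j' si sj'.
by apply: H; rewrite // inE si orbT.
Qed.

Lemma dmat_col (T : A) (X Y : int -> A) (phi : forall j j', hom (X j) (Y j'))
    (u : forall j, hom T (X j)) s s' :
  dmat phi s s' \c dcol u s =
  dcol (fun j' => \sum_(j <- s) (phi j j' \c u j)) s'.
Proof.
elim: s => [|j s IH] /=.
  by rewrite comp0m dcol0 // => j' _; rewrite big_nil.
rewrite compDl !compDr -!compA !(compA pr1) !(compA pr2).
rewrite pr1_in1 pr1_in2 pr2_in1 pr2_in2 !comp1m !comp0m !compm0 addr0 add0r.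
rewrite IH dcol_comp -dcolD; apply: eq_dcol => j' _.
by rewrite big_cons.
Qed.

Lemma dmat_comp (X Y Z : int -> A) (psi : forall j j', hom (Y j) (Z j'))
    (phi : forall j j', hom (X j) (Y j')) s s' s'' :
  dmat psi s' s'' \c dmat phi s s' =
  dmat (fun j j'' => \sum_(j' <- s') (psi j' j'' \c phi j j')) s s''.
Proof.
elim: s => [|j s IH] /=; first by rewrite compm0.
by rewrite compDr !compA IH dmat_col.
Qed.

Lemma spreadE h (X Y : int -> A) (phi : forall j, hom (X j) (Y (h j))) j :
  spread phi j (h j) = phi j.
Proof.
rewrite /spread; case: eqP => // e.
by rewrite (Prop_irrelevance e erefl).
Qed.

Lemma spread0 h (X Y : int -> A) (phi : forall j, hom (X j) (Y (h j))) j j' :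
  h j != j' -> spread phi j j' = 0.
Proof. by rewrite /spread; case: eqP. Qed.

Lemma spread_comp h h' (X Y Z : int -> A) (psi : forall j, hom (Y j) (Z (h' j)))
    (phi : forall j, hom (X j) (Y (h j))) (s' : seq int) j j'' :
  uniq s' -> (h j \notin s' -> is_zero (Y (h j))) ->
  \sum_(j' <- s') (spread psi j' j'' \c spread phi j j') =
  spread (h := h' \o h) (fun j => psi (h j) \c phi j) j j''.
Proof.
move=> us' H.
have E : spread psi (h j) j'' \c phi j =
    spread (h := h' \o h) (fun j => psi (h j) \c phi j) j j''.
  have [e|ne] := eqVneq (h' (h j)) j''.
    by case: _ / e; rewrite (spreadE psi) (@spreadE (h' \o h)).
  by rewrite !spread0 // comp0m.
have [sj|sj] := boolP (h j \in s').
  rewrite (bigD1_seq (h j)) //= (spreadE phi) E big1 ?addr0 // => i ne.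
  by rewrite (spread0 phi) ?compm0 // eq_sym.
rewrite -E (proj2 (H sj) _ (phi j)) compm0 big_seq big1 // => i si.
rewrite (spread0 phi) ?compm0 //; apply: contraNneq sj => ->.
exact: si.
Qed.

Lemma dmat_id (X : int -> A) s : uniq s ->
  dmat (spread (h := id) (fun j => idm (X j))) s s = idm (dsum X s).
Proof.
pose one : forall j j', hom (X j) (X j') :=
  spread (h := id) (fun j => idm (X j)).
rewrite -/one.
have K t t' j : j \notin t -> uniq t ->
    dmat one t (j :: t') = in2 \c dmat one t t'.
  elim: t => [|i t IH] /=; first by rewrite compm0.
  rewrite inE negb_or => /andP[ne nt] /andP[_ ut].
  rewrite IH // /one spread0; last by rewrite eq_sym.
  by rewrite compm0 add0r compDr !compA.
elim: s => [_|j s IH /= /andP[nj us]] /=.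
  by rewrite [RHS]from_zero.
rewrite K // IH // compm1 dcol0 => [|i si]; last first.
  by rewrite /one spread0 //; apply: contraNneq nj => ->.
by rewrite compm0 addr0 /one (@spreadE id) compm1 bip_id.
Qed.

Definition bound (X : bcomplex) : nat := projT1 (cid (bounded X)).

Section Compression.
Variable m : nat.

(* The integers j with |j| <= N and j = i mod m. The summands of F_m(X)^i    *)
(* are indexed by j = i + t m instead of t, so that F_m(X)^i and             *)
(* F_m(X)^(i + m) are equal and not merely isomorphic; summands outside of   *)
(* the bound of X are zero objects and are left out.                         *)
Definition residues (N : nat) (i : int) : seq int :=
  [seq j <- [seq n%:Z - N%:Z | n <- iota 0 (N + N).+1] | (j == i %[mod m])%Z].

Lemma mem_residues N i j :
  (j \in residues N i) = (`|j| <= N)%N && (j == i %[mod m])%Z.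
Proof.
rewrite mem_filter andbC; congr andb; apply/mapP/idP => [[n]|le].
  by rewrite mem_iota => /andP[_ lt] ->; lia.
exists `|(j + N%:Z)%R|%N; last by lia.
by rewrite mem_iota; lia.
Qed.

Lemma residues_uniq N i : uniq (residues N i).
Proof.
apply: filter_uniq; rewrite map_inj_uniq ?iota_uniq // => n n' /=.
by move=> /addIr [].
Qed.

Lemma residues_mod N (i j : int) :
  (i = j %[mod m])%Z -> residues N i = residues N j.
Proof. by move=> e; apply: eq_filter => x; rewrite e. Qed.

Lemma residues_zero (X : bcomplex) i j :
  (j = i %[mod m])%Z -> j \notin residues (bound X) i -> is_zero (X j).
Proof.
move=> e; rewrite mem_residues e eqxx andbT -ltnNge.
exact: (projT2 (cid (bounded X))).
Qed.

Lemma residues_shift N i j :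
  j \in residues N i -> (j + 1 = i + 1 %[mod m])%Z.
Proof.
rewrite mem_residues => /andP[_ /eqP e].
by rewrite -(modzDml j) e modzDml.
Qed.

Definition compr_ob (X : bcomplex) (i : int) : A :=
  dsum X (residues (bound X) i).

Definition compr_d (X : bcomplex) (i : int) :
    hom (compr_ob X i) (compr_ob X (i + 1)) :=
  dmat (spread (h := fun j => j + 1) (d X))
    (residues (bound X) i) (residues (bound X) (i + 1)).

Definition compr_map (X Y : bcomplex) (f : chain_map X Y) (i : int) :
    hom (compr_ob X i) (compr_ob Y i) :=
  dmat (spread (h := id) f) (residues (bound X) i) (residues (bound Y) i).

Lemma compr_dd (X : bcomplex) i : compr_d X (i + 1) \c compr_d X i = 0.
Proof.
rewrite /compr_d dmat_comp; apply: dmat0 => j j'' sj sj''.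
rewrite spread_comp ?residues_uniq //; last first.
  exact/residues_zero/(residues_shift sj).
rewrite /spread; case: eqP => // e; case: _ / e.
exact: dd.
Qed.

Definition compr_cx (X : bcomplex) : complex := Complex (@compr_dd X).

Lemma compr_per_ob (X : bcomplex) (i j : int) :
  (i = j %[mod m])%Z -> compr_cx X i = compr_cx X j.
Proof. by move=> e; rewrite /= /compr_ob (residues_mod _ e). Qed.

Lemma compr_per_d (X : bcomplex) (i j : int) :
  (i = j %[mod m])%Z -> Arrow (d (compr_cx X) i) = Arrow (d (compr_cx X) j).
Proof.
move=> e; have e1 : (i + 1 = j + 1 %[mod m])%Z by rewrite -modzDml e modzDml.
by rewrite /= /compr_d /compr_ob (residues_mod _ e) (residues_mod _ e1).
Qed.

Definition compr_pcx (X : bcomplex) : pcomplex m :=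
  PComplex (@compr_per_ob X) (@compr_per_d X).

Lemma compr_mapP (X Y : bcomplex) (f : chain_map X Y) i :
  d (compr_cx Y) i \c compr_map f i = compr_map f (i + 1) \c d (compr_cx X) i.
Proof.
rewrite /= /compr_d /compr_map !dmat_comp; apply: eq_dmat => j j'' sj sj''.
rewrite !spread_comp ?residues_uniq //.
- rewrite /spread /=; case: eqP => // e; case: _ / e.
  exact: cmapP.
- exact/residues_zero/(residues_shift sj).
- move: sj; rewrite mem_residues => /andP[_ /eqP].
  exact: residues_zero.
Qed.

Definition compr_chain (X Y : bcomplex) (f : chain_map X Y) :
  chain_map (compr_cx X) (compr_cx Y) :=
  @ChainMap (compr_cx X) (compr_cx Y) (compr_map f) (@compr_mapP X Y f).

Lemma compr_per_map (X Y : bcomplex) (f : chain_map X Y) (i j : int) :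
  (i = j %[mod m])%Z -> Arrow (compr_chain f i) = Arrow (compr_chain f j).
Proof.
by move=> e; rewrite /= /compr_map /compr_ob !(residues_mod _ e).
Qed.

Definition compr_pmap (X Y : bcomplex) (f : chain_map X Y) :
  pmap (compr_pcx X) (compr_pcx Y) :=
  @PMap _ (compr_pcx X) (compr_pcx Y) (compr_chain f) (@compr_per_map X Y f).

Lemma compr_pmap1 (X : bcomplex) :
  compr_pmap (chain_id X) = pmap_id (compr_pcx X).
Proof. by apply: pmap_eq => i; apply/dmat_id/residues_uniq. Qed.

Lemma compr_pmapM (X Y Z : bcomplex) (g : chain_map Y Z) (f : chain_map X Y) :
  compr_pmap (chain_comp g f) = pmap_comp (compr_pmap g) (compr_pmap f).
Proof.
apply: pmap_eq => i /=; rewrite /compr_map dmat_comp.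
apply: eq_dmat => j j'' sj sj''; rewrite spread_comp ?residues_uniq //.
move: sj; rewrite mem_residues => /andP[_ /eqP].
exact: residues_zero.
Qed.

Definition compression : functor Cb (Cper m) :=
  @Functor Cb (Cper m) compr_pcx compr_pmap compr_pmap1 compr_pmapM.

End Compression.
End Complexes.
Arguments Cb {k} A.
Arguments Cper {k} A m.
Arguments compression {k} A m.

(* Main.v *)
Require Import Defs.
From mathcomp Require Import all_boot all_order all_algebra.

(** The compression functor F forgets no information that sections or
    retractions could see, because it is separable: the maps
    Hom(X, Y) -> Hom(F X, F Y) have left inverses that are natural in X and Y.
    Such an inverse extracts the diagonal of a matrix.  A chain map u between
    compressions has in degree j a component X^j -> Y^j, and these components
    commute with the differentials since the differential of a compression takes
    the summand j to the summand j + 1 and to no other: the entries of d u and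
    of u d from the summand j to the summand j + 1 involve no entry of u off
    the diagonal ([diagonal]).  As compressed maps are themselves diagonal,
    taking diagonals commutes with composing on either side with one of them
    ([diagonal_compr], [compr_diagonal]), although not with composition in
    general.

    A separable functor reflects sections and retractions: if u (F g) = 1 then
    the diagonal of u is a left inverse of g, and dually.  Every functor
    preserves them, so a factorisation f = h g with F f irreducible makes F g a
    section or F h a retraction, hence g a section or h a retraction
    ([separable_irreducible]). *)

Set Implicit Arguments.
Unset Strict Implicit.
Unset Printing Implicit Defensive.

Import GRing.Theory.
(* The ring theory also exports the names additive and comp. *)
Import Defs.
Local Open Scope ring_scope.

(** The hypotheses on [r] say that [F] is separable; [r (fmap F f) = f] is the
    case [u := idc _] of either naturality equation. *)
Lemma separable_irreducible (C D : category) (F : functor C D)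
    (r : forall X Y : C, mor (F X) (F Y) -> mor X Y)
    (r1 : forall X : C, r X X (idc (F X)) = idc X)
    (rMl : forall (X Y Z : C) (h : mor Y Z) (u : mor (F X) (F Y)),
      r X Z (compc (fmap F h) u) = compc h (r X Y u))
    (rMr : forall (X Y Z : C) (u : mor (F Y) (F Z)) (g : mor X Y),
      r X Z (compc u (fmap F g)) = compc (r Y Z u) g)
    (X Y : C) (f : mor X Y) :
  irreducible (fmap F f) -> irreducible f.
Proof.
move=> [nsec nret irr]; split.
- move=> [h hf]; apply: nsec; exists (fmap F h).
  by rewrite -fmapM hf fmap1.
- move=> [h fh]; apply: nret; exists (fmap F h).
  by rewrite -fmapM fh fmap1.
move=> Z g h fE; have := irr _ (fmap F g) (fmap F h).
rewrite -fmapM -fE => /(_ erefl) [[u ug]|[u hu]]; [left|right].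
  by exists (r _ _ u); rewrite -rMr ug r1.
by exists (r _ _ u); rewrite -rMl hu r1.
Qed.

Section Diagonal.
Variables (k : comPzRingType) (A : additive k).

Section Summands.
Implicit Types (X Y : int -> A) (s : seq int).

(** The inclusion of the summand [j]; it is zero when [s] omits [j], which is
    harmless where [X j] is then a zero object. *)
Definition dinj X s (j : int) : hom (X j) (dsum X s) :=
  dcol (spread (h := id) (fun i => idm (X i)) j) s.

(** The projection onto the summand [j], written as a matrix with a single row
    so that the calculus of [dmat] applies to it. *)
Definition dproj X s (j : int) : hom (dsum X s) (X j) :=
  pr1 \c dmat (spread (h := id) (fun i => idm (X i))) s [:: j].

Lemma dproj_dinj X s j : uniq s -> (j \notin s -> is_zero (X j)) ->
  dproj X s j \c dinj X s j = idm (X j).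
Proof.
move=> us zX; rewrite /dproj /dinj -compA (dmat_col _ _ s [:: j]) /= compDr !compA.
rewrite pr1_in1 pr1_in2 comp1m comp0m addr0 spread_comp //.
by rewrite (@spreadE _ _ (id \o id)) compm1.
Qed.

(** Each column of [spread phi] has one entry, so that only the summand [h j]
    of the target is met from the summand [j]. *)
Lemma dmat_dinj (h : int -> int) X Y (phi : forall j, hom (X j) (Y (h j)))
    s s' j : uniq s -> (j \notin s -> is_zero (X j)) ->
  dmat (spread phi) s s' \c dinj X s j = dinj Y s' (h j) \c phi j.
Proof.
move=> us zX; rewrite dmat_col dcol_comp; apply: eq_dcol => j' _.
rewrite spread_comp //; have [e|ne] := eqVneq (h j) j'.
  case: _ / e; rewrite (@spreadE _ _ (h \o id)) compm1.
  by rewrite (@spreadE _ _ id) comp1m.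
by rewrite !spread0 // comp0m.
Qed.

(** If [h] is injective, each row of [spread phi] has at most one entry too, so
    that the summand [h j] of the target is met only from the summand [j]. *)
Lemma dproj_dmat (h : int -> int) X Y (phi : forall j, hom (X j) (Y (h j)))
    s s' j : injective h -> uniq s' ->
    {in s, forall i, h i \notin s' -> is_zero (Y (h i))} ->
  dproj Y s' (h j) \c dmat (spread phi) s s' = phi j \c dproj X s j.
Proof.
move=> injh us' zY; rewrite /dproj.
have row : phi j \c pr1 = pr1 \c dmat (spread phi) [:: j] [:: h j].
  rewrite /= spreadE compm0 comp0m !addr0 compA compA pr1_in1.
  by rewrite comp1m.
rewrite compA row -!compA (dmat_comp _ _ s s' [:: h j]).
rewrite (dmat_comp _ _ s [:: j] [:: h j]); congr (_ \c _).
apply: (eq_dmat (s' := [:: h j])) => i j'; rewrite inE => si /eqP ->.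
rewrite spread_comp //; last exact: zY.
rewrite big_seq1 spreadE; have [->|ne] := eqVneq i j.
  by rewrite (@spreadE _ _ (id \o h)) (@spreadE _ _ id) comp1m compm1.
by rewrite !spread0 ?compm0 //= (inj_eq injh).
Qed.

End Summands.

Section Compression.
Variable m : nat.

(** In degree [j] the summands of a compression are indexed by the residue
    class of [j], so [j] is one of them or else its summand is zero. *)
Lemma residues_self (X : bcomplex A) j :
  j \notin residues m (bound X) j -> is_zero (X j).
Proof. exact: residues_zero. Qed.

Definition diagonal_map (X Y : bcomplex A)
    (u : chain_map (compr_cx m X) (compr_cx m Y)) (j : int) :
    hom (X j) (Y j) :=
  dproj Y (residues m (bound Y) j) j \c u j
    \c dinj X (residues m (bound X) j) j.

Lemma diagonal_mapP (X Y : bcomplex A)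
    (u : chain_map (compr_cx m X) (compr_cx m Y)) j :
  d Y j \c diagonal_map u j = diagonal_map u (j + 1) \c d X j.
Proof.
have dprojE : d Y j \c dproj Y (residues m (bound Y) j) j =
    dproj Y (residues m (bound Y) (j + 1)) (j + 1) \c compr_d m Y j.
  rewrite [RHS](dproj_dmat (h := +%R^~ 1) (d Y) _ (@addIr _ 1)) ?residues_uniq //.
  by move=> i /residues_shift; apply: residues_zero.
have dinjE : compr_d m X j \c dinj X (residues m (bound X) j) j =
    dinj X (residues m (bound X) (j + 1)) (j + 1) \c d X j.
  rewrite [LHS](dmat_dinj (h := +%R^~ 1) (d X)) ?residues_uniq //.
  exact: residues_self.
rewrite /diagonal_map 2!(compA (d Y j)) dprojE -[RHS]compA -dinjE.
rewrite [RHS]compA -(compA _ (compr_d m Y j)) -[in RHS](compA _ (u (j + 1))).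
by congr (_ \c _ \c _); apply: (cmapP u).
Qed.

Definition diagonal (X Y : bcomplex A)
    (u : chain_map (compr_cx m X) (compr_cx m Y)) : chain_map X Y :=
  ChainMap (diagonal_mapP u).

Lemma diagonal1 (X : bcomplex A) :
  diagonal (chain_id (compr_cx m X)) = chain_id X.
Proof.
apply: chain_map_eq => j /=; rewrite /diagonal_map /= compm1.
by rewrite dproj_dinj ?residues_uniq //; apply: residues_self.
Qed.

Lemma compr_diagonal (X Y Z : bcomplex A) (h : chain_map Y Z)
    (u : chain_map (compr_cx m X) (compr_cx m Y)) :
  diagonal (chain_comp (compr_chain m h) u) = chain_comp h (diagonal u).
Proof.
apply: chain_map_eq => j /=; rewrite /diagonal_map /= 2!(compA (h j)).
rewrite -(dproj_dmat (h := id) h (s := residues m (bound Y) j)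
  (s' := residues m (bound Z) j)) ?residues_uniq ?compA // => i.
by rewrite mem_residues => /andP[_ /eqP]; apply: residues_zero.
Qed.

Lemma diagonal_compr (X Y Z : bcomplex A)
    (u : chain_map (compr_cx m Y) (compr_cx m Z)) (g : chain_map X Y) :
  diagonal (chain_comp u (compr_chain m g)) = chain_comp (diagonal u) g.
Proof.
apply: chain_map_eq => j /=; rewrite /diagonal_map /= -[RHS]compA.
rewrite (compA _ (u j)) -[LHS]compA; congr (_ \c _).
apply: (dmat_dinj (h := id)); first exact: residues_uniq.
exact: residues_self.
Qed.

End Compression.
End Diagonal.

Theorem lemma2p8 (k : comPzRingType) (A : additive k) (m : nat)
    (m_gt0 : (0 < m)%N) (X Y : Cb A) (f : mor X Y) :
  irreducible (fmap (compression A m) f) -> irreducible f.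
Proof.
apply: (@separable_irreducible _ _ (compression A m)
  (fun (U V : Cb A) u => diagonal (pcmap u))).
- by move=> Z; apply: diagonal1.
- by move=> U V W h u; apply: compr_diagonal.
- by move=> U V W u g; apply: diagonal_compr.
Qed.
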